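(* Let $\Delta$ be a simplex in euclidean $n$-dimensional space with vertices $A_0,A_1,\ldots,A_n$. Consider the face $\Delta_0$ of $\Delta$ opposite to $A_0$, and let $\pi_0$ be the hyperplane containing $\Delta_0$. Let $\pi_1,\pi_2,\ldots,\pi_n$ be the hyperplanes orthogonal to $A_0A_1,A_0A_2,\ldots,A_0A_n$ through $A_1,A_2,\ldots,A_n$, respectively, and let $C$ be the intersection point of $\pi_1,\pi_2,\ldots,\pi_n$. If $A_*, C_*$ are the orthogonal projections of $A_0, C$ onto $\pi_0$, then the midpoint of $\overline{A_*C_*}$ is the circumcenter of $\Delta_0$.
   Context: Simplices are non-degenerate (the vertices $A_0,\ldots,A_n$ are affinely independent). The circumcenter of $\Delta_0$ is the unique point of the hyperplane $\pi_0$ equidistant from $A_1,\ldots,A_n$. The midpoint of a degenerate segment (equal endpoints) is that endpoint. *)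

(* Defs.v *)
From mathcomp Require Import all_boot all_order all_algebra.
From mathcomp Require Import boolp classical_sets reals.

Set Implicit Arguments.
Unset Strict Implicit.
Unset Printing Implicit Defensive.
Import Order.TTheory GRing.Theory Num.Theory.
Local Open Scope ring_scope.
Local Open Scope classical_set_scope.

Section EuclideanSpace.
Variables (R : realType) (n : nat).
Implicit Types (P Q p q x u v : 'rV[R]_n) (H : set 'rV[R]_n).
Implicit Types (A : 'I_n.+1 -> 'rV[R]_n).

Definition dot u v : R := \sum_(j < n) u 0 j * v 0 j.

(* Not `|P - Q|, which is the max norm on 'rV[R]_n in MathComp-Analysis. *)
Definition edist P Q : R := Num.sqrt (dot (P - Q) (P - Q)).

Definition midpoint P Q : 'rV[R]_n := 2^-1 *: (P + Q).

Definition hyperplane H : Prop :=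
  exists (v : 'rV[R]_n) (c : R), v != 0 /\ H = [set x | dot v x = c].

(* The hyperplane through Q orthogonal to the line PQ. *)
Definition perp_hyperplane P Q : set 'rV[R]_n :=
  [set x | dot (Q - P) (x - Q) = 0].

Definition orth_proj H p q : Prop :=
  H q /\ forall x, H x -> dot (p - q) (x - q) = 0.

Definition affinely_independent A : Prop :=
  forall w : 'I_n.+1 -> R, \sum_i w i = 0 -> \sum_i w i *: A i = 0 ->
  forall i, w i = 0.

(* The convex hull of the vertices A i with i != k. *)
Definition face A (k : 'I_n.+1) : set 'rV[R]_n :=
  [set x | exists w : 'I_n.+1 -> R,
    [/\ forall i, 0 <= w i, w k = 0, \sum_i w i = 1 & x = \sum_i w i *: A i]].

Definition equidistant A (k : 'I_n.+1) x : Prop :=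
  forall i j, i != k -> j != k -> edist x (A i) = edist x (A j).

(* H is meant to be the hyperplane containing the face opposite to A k.
   [unique] asserts both the property and its uniqueness. *)
Definition circumcenter H A (k : 'I_n.+1) x : Prop :=
  unique (fun y => H y /\ equidistant A k y) x.

Lemma dotC u v : dot u v = dot v u.
Proof. by apply: eq_bigr => j _; rewrite mulrC. Qed.

Lemma dotBr u v x : dot u (v - x) = dot u v - dot u x.
Proof. by rewrite -sumrB; apply: eq_bigr => j _; rewrite !mxE mulrBr. Qed.

Lemma dotZr (a : R) u v : dot u (a *: v) = a * dot u v.
Proof. by rewrite mulr_sumr; apply: eq_bigr => j _; rewrite !mxE mulrCA. Qed.

Lemma dot_eq0 u : (dot u u == 0) = (u == 0).
Proof.
apply/eqP/eqP => [u0|->]; last by apply: big1 => j _; rewrite mxE mul0r.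
apply/rowP => j; rewrite mxE; apply/eqP; rewrite -sqrf_eq0 expr2; apply/eqP.
by apply: (psumr_eq0P _ u0) => // i _; rewrite -expr2 sqr_ge0.
Qed.

Lemma orth_proj_exists_unique H p : hyperplane H -> exists! q, orth_proj H p q.
Proof.
move=> [v [c [v0 ->]]]; set t := (dot v p - c) / dot v v.
have vv0 : dot v v != 0 by rewrite dot_eq0.
have vq : dot v (p - t *: v) = c.
  by rewrite dotBr dotZr /t divfK // opprB addrC subrK.
have pq : p - (p - t *: v) = t *: v by rewrite opprB addrC subrK.
exists (p - t *: v); split; first split=> [|x /= xc]; first exact: vq.
  by rewrite pq dotC dotZr dotC dotBr xc vq subrr mulr0.
move=> q [/= qc hq].
have h1 := hq _ vq.
set d := p - t *: v - q in h1 *.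
have pd : p - q = d + t *: v by rewrite /d addrAC subrK.
have dv : dot d v = 0 by rewrite dotC /d dotBr vq qc subrr.
have : dot d d = 0.
  have -> : dot d d = dot d (p - q) - dot d (t *: v).
    by rewrite -dotBr pd addrK.
  by rewrite dotC h1 dotZr dv mulr0 subrr.
by move/eqP; rewrite dot_eq0 subr_eq0 => /eqP.
Qed.

End EuclideanSpace.

(* Main.v *)
(** Put [e_i = A_i - A_0].  Affine independence means that the system
    [e_i . x = c_i] (1 <= i <= n) has exactly one solution for every right-hand
    side, so the vectors having the same product with every [e_i] form a line,
    the line of normals of [pi_0].  The condition [e_i . (C - A_i) = 0] says that
    [A_i . (A_0 + C) - |A_i|^2 = A_0 . C] does not depend on [i].  Differences of
    the [A_i] are orthogonal to [A_0 - A_*] and [C - C_*], so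
    [A_i . (A_* + C_* ) - |A_i|^2] does not depend on [i] either, which says that
    the midpoint of [A_* C_*] is equidistant from the [A_i]. *)
Require Import Defs.
From mathcomp Require Import all_boot all_order all_algebra.
From mathcomp Require Import boolp classical_sets reals.
From mathcomp Require Import lra.
Import Order.TTheory GRing.Theory Num.Theory.
Local Open Scope ring_scope.
Local Open Scope classical_set_scope.

Section Dot.
Context {R : realType} {n : nat}.
Implicit Types (u v x p q : 'rV[R]_n) (H : set 'rV[R]_n).

Lemma dotDr u v x : dot u (v + x) = dot u v + dot u x.
Proof. by rewrite -big_split; apply: eq_bigr => j _; rewrite !mxE mulrDr. Qed.

Lemma dotr0 u : dot u 0 = 0.
Proof. by apply: big1 => j _; rewrite mxE mulr0. Qed.

Lemma dotDl u v x : dot (v + x) u = dot v u + dot x u.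
Proof. by rewrite dotC dotDr !(dotC u). Qed.

Lemma dotBl u v x : dot (v - x) u = dot v u - dot x u.
Proof. by rewrite dotC dotBr !(dotC u). Qed.

Lemma dot_sumr (I : finType) u (F : I -> 'rV[R]_n) :
  dot u (\sum_i F i) = \sum_i dot u (F i).
Proof.
apply: (big_morph (dot u)) => [x y|]; [exact: dotDr|exact: dotr0].
Qed.

Lemma dot_ge0 u : 0 <= dot u u.
Proof. by apply: sumr_ge0 => j _; rewrite -expr2 sqr_ge0. Qed.

Lemma eq_edist p u v :
  (edist p u = edist p v) <-> (dot (p - u) (p - u) = dot (p - v) (p - v)).
Proof.
split=> [|e]; last by rewrite /edist e.
by move/(congr1 (fun r => r ^+ 2)); rewrite !sqr_sqrtr ?dot_ge0.
Qed.

(** [p - q] is orthogonal to both [u - q] and [v - q], hence to their difference. *)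
Lemma orth_proj_dot {H p q u v} :
  orth_proj H p q -> H u -> H v -> dot (u - v) p = dot (u - v) q.
Proof.
move=> [_ pq] Hu Hv; move: (pq u Hu) (pq v Hv).
rewrite !(dotBl, dotBr) !(dotC p) !(dotC q); lra.
Qed.

End Dot.

Section Simplex.
Context {R : realType} {n : nat} {A : 'I_n.+1 -> 'rV[R]_n}.
Implicit Types (x d v : 'rV[R]_n) (H : set 'rV[R]_n).

Lemma vertex_face (k i : 'I_n.+1) : i != k -> face A k (A i).
Proof.
move=> ik; exists (fun j => (j == i)%:R); split=> [j|||].
- exact: ler0n.
- by rewrite eq_sym (negPf ik).
- by rewrite (bigD1 i) //= eqxx big1 ?addr0 // => j /negPf ->.
- rewrite (bigD1 i) //= eqxx scale1r big1 ?addr0 // => j /negPf ->.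
  by rewrite scale0r.
Qed.

Lemma face_sub_hyperplane (k : 'I_n.+1) v (c : R) :
  (forall i, i != k -> dot v (A i) = c) -> face A k `<=` [set x | dot v x = c].
Proof.
move=> vA x [w [_ wk w1 ->]] /=; rewrite dot_sumr.
rewrite -[RHS]mul1r -w1 mulr_suml; apply: eq_bigr => i _; rewrite dotZr.
by have [->|/vA ->] := eqVneq i k; first rewrite wk !mul0r.
Qed.

Hypothesis A_indep : affinely_independent A.

(** A row vector in the left kernel becomes an affine dependence once [A ord0] is given minus the
    sum of its entries as weight. *)
Lemma edge_mx_unit :
  (\matrix_(i < n) (A (lift ord0 i) - A ord0)) \in unitmx.
Proof.
rewrite -row_free_unit; apply: inj_row_free => v.
rewrite mulmx_sum_row; under eq_bigr => i _ do rewrite rowK scalerBr.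
rewrite sumrB -scaler_suml => v0; apply/rowP => j; rewrite mxE.
pose w i := if unlift ord0 i is Some k then v 0 k else - \sum_k v 0 k.
have w0 : w ord0 = - \sum_k v 0 k by rewrite /w unlift_none.
have wl k : w (lift ord0 k) = v 0 k by rewrite /w liftK.
rewrite -(wl j); apply: A_indep; rewrite big_ord_recl.
  by under eq_bigr => k _ do rewrite wl; rewrite w0 addNr.
by under eq_bigr => k _ do rewrite wl; rewrite w0 scaleNr addrC.
Qed.

(** The left-hand sides are the entries of the invertible edge matrix times the column [x^T]. *)
Lemma edge_system (c : 'I_n.+1 -> R) :
  exists! x, forall i, i != ord0 -> dot (A i - A ord0) x = c i.
Proof.
have Mu := edge_mx_unit; set M := (\matrix_i _) in Mu.
have Mx x : (forall i, i != ord0 -> dot (A i - A ord0) x = c i) <->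
    M *m x^T = \col_i c (lift ord0 i).
  have dM i : (M *m x^T) i 0 = dot (A (lift ord0 i) - A ord0) x.
    by rewrite mxE; apply: eq_bigr => j _; rewrite !mxE.
  split=> [h|/colP h i].
    by apply/colP => i; rewrite dM mxE h // eq_sym neq_lift.
  by case: (unliftP ord0 i) => [k ->|-> /eqP//]; rewrite -dM h mxE.
exists (invmx M *m \col_i c (lift ord0 i))^T; split=> [|x /Mx <-].
  by apply/Mx; rewrite trmxK mulKVmx.
by rewrite mulKmx // trmxK.
Qed.

(** Solutions for constant right-hand sides are proportional, by uniqueness. Below, [v] is a normal
    of a hyperplane containing the face. *)
Lemma edge_normal {v d} {s t : R} : v != 0 ->
  (forall i, i != ord0 -> dot (A i - A ord0) v = s) ->
  (forall i, i != ord0 -> dot (A i - A ord0) d = t) ->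
  s != 0 /\ d = (t / s) *: v.
Proof.
move=> v0 vs dt.
have s0 : s != 0.
  (* The homogeneous system has only the zero solution, so [s = 0] would force [v = 0]. *)
  have [x [_ x_uniq]] := edge_system (fun=> 0).
  apply: contra v0 => /eqP s0; rewrite -(x_uniq v) ?s0 // => [|i i0].
    by rewrite (x_uniq 0) // => i _; rewrite dotr0.
  by rewrite vs.
split=> //; have [x [_ x_uniq]] := edge_system (fun=> t).
by rewrite -(x_uniq d) // -(x_uniq ((t / s) *: v)) // => i i0;
  rewrite dotZr vs // divfK.
Qed.

Lemma face_hyperplane : (0 < n)%N ->
  exists! H, hyperplane H /\ face A ord0 `<=` H.
Proof.
(* The value 1 selects one nonzero normal of the face among its multiples. *)
move=> n_gt0; have [v [v1 _]] := edge_system (fun=> 1).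
have k0 : lift ord0 (Ordinal n_gt0) != ord0 by rewrite eq_sym neq_lift.
have v0 : v != 0.
  apply: contra_eq_neq (v1 _ k0) => ->.
  by rewrite dotr0 eq_sym oner_eq0.
have vA i : i != ord0 -> dot v (A i) = 1 + dot v (A ord0).
  by move=> /v1; rewrite dotC dotBr => <-; rewrite subrK.
exists [set x | dot v x = 1 + dot v (A ord0)]; split.
  by split; [exists v, (1 + dot v (A ord0))|exact: face_sub_hyperplane].
move=> _ [[u [c [u0 ->]]] face_u].
have uA i : i != ord0 -> dot u (A i) = c.
  by move=> i0; apply: face_u; apply: vertex_face.
have ue i : i != ord0 -> dot (A i - A ord0) u = c - dot u (A ord0).
  by move=> i0; rewrite dotC dotBr uA.
(* Both normals have constant products with the edges, so [v] is a nonzero multiple of [u]. *)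
have [s0 vu] := edge_normal u0 ue v1.
set s := c - dot u (A ord0) in s0 vu.
have vux x : dot v x = s^-1 * dot u x by rewrite vu dotC dotZr dotC mul1r.
apply/seteqP; split=> x /=; rewrite -(vA _ k0) !vux uA // => e.
  by apply: (mulfI (invr_neq0 s0)).
by rewrite e.
Qed.

(** Expanding the orthogonality conditions gives an edge system whose right-hand side is known. *)
Lemma perp_hyperplanes_meet :
  exists! C, forall i, i != ord0 -> perp_hyperplane (A ord0) (A i) C.
Proof.
have [C [hC C_uniq]] := edge_system (fun i => dot (A i - A ord0) (A i)).
exists C; split=> [i i0|D hD].
  by rewrite /perp_hyperplane /= dotBr hC // subrr.
apply: C_uniq => i i0; apply/eqP; rewrite -subr_eq0 -dotBr.
exact/eqP/hD.
Qed.

(** Equidistance makes [x - y] a multiple of the normal of [H], while membership in [H] makes it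
    orthogonal to that normal; so it vanishes. *)
Lemma equidistant_inj {H x y} : (0 < n)%N -> hyperplane H ->
  face A ord0 `<=` H -> H x -> H y ->
  equidistant A ord0 x -> equidistant A ord0 y -> x = y.
Proof.
move=> n_gt0 [v [c [v0 ->]]] face_v /= xc yc ex ey.
have vA i : i != ord0 -> dot v (A i) = c.
  by move=> i0; apply: face_v; apply: vertex_face.
have k0 : lift ord0 (Ordinal n_gt0) != ord0 by rewrite eq_sym neq_lift.
have ve i : i != ord0 -> dot (A i - A ord0) v = c - dot v (A ord0).
  by move=> i0; rewrite dotC dotBr vA.
have de i : i != ord0 -> dot (A i - A ord0) (x - y) =
    dot (A (lift ord0 (Ordinal n_gt0)) - A ord0) (x - y).
  move: (lift _ _) k0 => k k0 i0.
  (* Subtracting the equations for [x] and [y] cancels all squared norms. *)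
  move: (ex i k i0 k0) (ey i k i0 k0) => /eq_edist + /eq_edist.
  rewrite !(dotBl, dotBr) !(dotC _ x) !(dotC _ y); lra.
have [s0 xy] := edge_normal v0 ve de.
have : dot v (x - y) = 0 by rewrite dotBr xc yc subrr.
rewrite {1}xy dotZr => /eqP; rewrite mulf_eq0 dot_eq0 (negPf v0) orbF => /eqP t0.
by apply/eqP; rewrite -subr_eq0 xy t0 scale0r.
Qed.

End Simplex.

Lemma hyperplane_midpoint {R : realType} {n : nat} {H : set 'rV[R]_n} {p q} :
  hyperplane H -> H p -> H q -> H (midpoint p q).
Proof.
move=> [v [c [_ ->]]] /= pc qc.
by rewrite /midpoint dotZr dotDr pc qc; lra.
Qed.

Lemma equidistant_midpoint {R : realType} {n : nat} {A : 'I_n.+1 -> 'rV[R]_n}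
    {H : set 'rV[R]_n} {C A_star C_star : 'rV[R]_n} :
  face A ord0 `<=` H ->
  (forall i, i != ord0 -> perp_hyperplane (A ord0) (A i) C) ->
  orth_proj H (A ord0) A_star -> orth_proj H C C_star ->
  equidistant A ord0 (midpoint A_star C_star).
Proof.
move=> faceH hC projA projC i j i0 j0; apply/eq_edist.
have HA k : k != ord0 -> H (A k) by move=> /vertex_face /faceH.
move: (orth_proj_dot projA (HA i i0) (HA j j0)).
move: (orth_proj_dot projC (HA i i0) (HA j j0)).
move: (hC i i0) (hC j j0); rewrite /perp_hyperplane /midpoint /=.
(* Once expanded, everything is linear in the dot products: subtract the [hC] equations for [i] and
   [j], then replace [A ord0] and [C] by their projections in the products with [A i - A j]. *)
rewrite !(dotBl, dotBr, dotZr, dotDl, dotDr) !(dotC (_ *: _)).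
rewrite !(dotBl, dotBr, dotZr, dotDl, dotDr).
rewrite !(dotC _ (A i)) !(dotC _ (A j)) !(dotC (A ord0)).
lra.
Qed.

Theorem theorem12 (R : realType) (n : nat) (n_gt0 : (0 < n)%N)
    (A : 'I_n.+1 -> 'rV[R]_n) (A_indep : affinely_independent A) :
  [/\ (exists! pi0 : set 'rV[R]_n, hyperplane pi0 /\ face A ord0 `<=` pi0),
      (exists! C : 'rV[R]_n,
         forall i : 'I_n.+1, i != ord0 -> perp_hyperplane (A ord0) (A i) C)
    & forall (pi0 : set 'rV[R]_n) (C A_star C_star : 'rV[R]_n),
        hyperplane pi0 -> face A ord0 `<=` pi0 ->
        (forall i : 'I_n.+1, i != ord0 ->
           perp_hyperplane (A ord0) (A i) C) ->
        orth_proj pi0 (A ord0) A_star -> orth_proj pi0 C C_star ->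
        circumcenter pi0 A ord0 (midpoint A_star C_star)].
Proof.
split; [exact: face_hyperplane|exact: perp_hyperplanes_meet|].
move=> H C A_star C_star hypH faceH hC projA projC.
have Hm := hyperplane_midpoint hypH projA.1 projC.1.
have em := equidistant_midpoint faceH hC projA projC.
by split=> // y [Hy ey]; apply: (equidistant_inj A_indep n_gt0 hypH faceH).
Qed.
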